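(* For every integer $k\ge 1$, define the formal power series $$\hat C_k(q)=(-1)^{k-1}\Biggl(1-\frac{1}{(q;q)_\infty}\sum_{n=-k}^{k}(-1)^n q^{n(3n-1)/2}\Biggr)\prod_{n=1}^{\infty}\bigl(q^{2^n n};q^{2^{n+1}n}\bigr)_\infty.$$ Then $\hat C_k(q)$ has nonnegative coefficients for all $k\ge 1$. Furthermore, writing $\hat C_k(q)=\sum_{n\ge 0}\hat c_k(n)q^n$, we have $\hat c_k(n)>0$ if and only if $n\ge g_k+(2k+1)$, where $g_k=\frac{k(3k+1)}{2}$.
   Context: All series are formal power series in $q$ with integer coefficients. $(a;q)_\infty:=\prod_{i\ge 0}(1-aq^i)$; thus $(q;q)_\infty=\prod_{m\ge 1}(1-q^m)$ and $\bigl(q^{2^n n};q^{2^{n+1}n}\bigr)_\infty=\prod_{i\ge 0}\bigl(1-q^{2^n n(2i+1)}\bigr)$. For $k\ge 1$, $g_k:=\frac{k(3k+1)}{2}$. *)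

(* Defs.v *)
From HB Require Import structures.
From mathcomp Require Import all_boot all_order all_algebra.
From mathcomp Require Import boolp classical_sets.

Set Implicit Arguments.
Unset Strict Implicit.
Unset Printing Implicit Defensive.

Import Order.TTheory GRing.Theory Num.Theory.
Local Open Scope ring_scope.

(* MathComp has no ring of formal power series: [fps] is Z[[q]], a series being
   its sequence of coefficients, with the Cauchy product. *)
Record fps := Fps { fcoef : nat -> int }.

Lemma fpsP (f g : fps) : (forall n, fcoef f n = fcoef g n) <-> f = g.
Proof.
split=> [|-> //]; case: f g => [f] [g] /= fg.
by congr Fps; apply/funext.
Qed.

HB.instance Definition _ := gen_eqMixin fps.
HB.instance Definition _ := gen_choiceMixin fps.

Definition fps_zero := Fps (fun=> 0).
Definition fps_opp (f : fps) := Fps (fun n => - fcoef f n).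
Definition fps_add (f g : fps) := Fps (fun n => fcoef f n + fcoef g n).
Definition fps_one := Fps (fun n => (n == 0%N)%:R).
Definition fps_mul (f g : fps) :=
  Fps (fun n => \sum_(i < n.+1) fcoef f i * fcoef g (n - i)).

Lemma fps_addA : associative fps_add.
Proof. by move=> f g h; apply/fpsP => n /=; rewrite addrA. Qed.
Lemma fps_addC : commutative fps_add.
Proof. by move=> f g; apply/fpsP => n /=; rewrite addrC. Qed.
Lemma fps_add0 : left_id fps_zero fps_add.
Proof. by move=> f; apply/fpsP => n /=; rewrite add0r. Qed.
Lemma fps_addN : left_inverse fps_zero fps_opp fps_add.
Proof. by move=> f; apply/fpsP => n /=; rewrite addNr. Qed.

HB.instance Definition _ :=
  GRing.isZmodule.Build fps fps_addA fps_addC fps_add0 fps_addN.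

Definition fps_trunc (N : nat) (f : fps) : {poly int} := \poly_(i < N) fcoef f i.

Lemma coef_fps_trunc N f m : (m < N)%N -> (fps_trunc N f)`_m = fcoef f m.
Proof. by move=> mN; rewrite coef_poly mN. Qed.

Lemma fps_mulE N f g m : (m < N)%N ->
  fcoef (fps_mul f g) m = (fps_trunc N f * fps_trunc N g)`_m.
Proof.
move=> mN; rewrite coefM /=; apply: eq_bigr => i _.
rewrite !coef_fps_trunc //; first by rewrite (leq_ltn_trans (leq_subr _ _)).
by rewrite (leq_ltn_trans _ mN) // -ltnS.
Qed.

Lemma fps_mulC : commutative fps_mul.
Proof. by move=> f g; apply/fpsP => n; rewrite !(@fps_mulE n.+1) // mulrC. Qed.

Lemma fps_mulA : associative fps_mul.
Proof.
have E f g h n : fcoef (fps_mul (fps_mul f g) h) n =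
    (fps_trunc n.+1 f * fps_trunc n.+1 g * fps_trunc n.+1 h)`_n.
  rewrite [LHS]/= coefM; apply: eq_bigr => i _.
  by rewrite -fps_mulE // coef_fps_trunc // ltnS leq_subr.
move=> f g h; apply/fpsP => n.
by rewrite fps_mulC !E mulrC mulrA.
Qed.

Lemma fps_mul1 : left_id fps_one fps_mul.
Proof.
move=> f; apply/fpsP => n /=.
rewrite big_ord_recl subn0 mul1r big1 ?addr0 // => i _.
by rewrite mul0r.
Qed.

Lemma fps_mulDl : left_distributive fps_mul fps_add.
Proof.
move=> f g h; apply/fpsP => n /=.
by rewrite -big_split /=; apply: eq_bigr => i _; rewrite mulrDl.
Qed.

Lemma fps_oner_neq0 : fps_one != 0 :> fps.
Proof. by apply/eqP => /fpsP /(_ 0%N). Qed.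

HB.instance Definition _ := GRing.Zmodule_isComNzRing.Build fps
  fps_mulA fps_mulC fps_mul1 fps_mulDl fps_oner_neq0.

Lemma fcoef0 n : fcoef 0 n = 0. Proof. by []. Qed.
Lemma fcoef1 n : fcoef 1 n = (n == 0%N)%:R. Proof. by []. Qed.
Lemma fcoefN f n : fcoef (- f) n = - fcoef f n. Proof. by []. Qed.
Lemma fcoefD f g n : fcoef (f + g) n = fcoef f n + fcoef g n. Proof. by []. Qed.
Lemma fcoefM f g n :
  fcoef (f * g) n = \sum_(i < n.+1) fcoef f i * fcoef g (n - i).
Proof. by []. Qed.

(* [fps_inv_seq f n] lists the first [n] coefficients of 1/f, obtained by solving
   f * (1/f) = 1 degree by degree. *)
Fixpoint fps_inv_seq (f : fps) (n : nat) : seq int :=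
  if n is m.+1 then
    let s := fps_inv_seq f m in
    rcons s ((fcoef f 0)^-1 *
             ((m == 0%N)%:R - \sum_(i < m) s`_i * fcoef f (m - i)))
  else [::].

Definition fps_unit : pred fps := fun f => fcoef f 0 \is a GRing.unit.

Definition fps_inv (f : fps) : fps :=
  if fps_unit f then Fps (fun n => (fps_inv_seq f n.+1)`_n) else f.

Lemma size_fps_inv_seq f n : size (fps_inv_seq f n) = n.
Proof. by elim: n => //= n IHn; rewrite size_rcons IHn. Qed.

Lemma nth_fps_inv_seq f n m :
  (m < n)%N -> (fps_inv_seq f n)`_m = (fps_inv_seq f m.+1)`_m.
Proof.
elim: n => // n IHn; rewrite ltnS leq_eqVlt => /predU1P[-> //|mn].
by rewrite [LHS]/= nth_rcons size_fps_inv_seq mn IHn.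
Qed.

Lemma fps_mulVr : {in fps_unit, left_inverse 1 fps_inv *%R}.
Proof.
move=> f fu; have {}fu : fps_unit f by []; apply/fpsP => n.
rewrite fcoefM fcoef1 /fps_inv fu big_ord_recr /= subnn.
rewrite nth_rcons size_fps_inv_seq ltnn eqxx mulrC mulVKr //.
under eq_bigr => i _.
  rewrite -[rcons _ _]/(fps_inv_seq f i.+1) -(@nth_fps_inv_seq _ n) //.
  over.
by rewrite addrC subrK.
Qed.

Lemma fps_unitPl f g : g * f = 1 -> fps_unit f.
Proof.
move=> /fpsP /(_ 0%N); rewrite fcoefM big_ord1 fcoef1 /= => gf1.
by apply/unitrPr; exists (fcoef g 0); rewrite mulrC.
Qed.

Lemma fps_inv_out : {in [predC fps_unit], fps_inv =1 id}.
Proof. by move=> f fu; rewrite /fps_inv ifN. Qed.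

HB.instance Definition _ := GRing.ComNzRing_hasMulInverse.Build fps
  fps_mulVr fps_unitPl fps_inv_out.

Definition fps_q : fps := Fps (fun n => (n == 1%N)%:R).

(* Coefficientwise (i.e. q-adic) limit: each coefficient of the limit is the
   eventual value of that coefficient along [u], and 0 by convention if it does
   not stabilize. *)
Definition fps_lim (u : nat -> fps) : fps :=
  Fps (fun m => xget 0 [set c : int |
    exists N0, forall N, (N0 <= N)%N -> fcoef (u N) m = c]).

Lemma fps_limE u m c N0 :
  (forall N, (N0 <= N)%N -> fcoef (u N) m = c) -> fcoef (fps_lim u) m = c.
Proof.
move=> uc /=; case: xgetP => [d _ [N1 ud]|/(_ c) []]; last by exists N0.
by rewrite -(ud _ (leq_maxr N0 N1)) uc // leq_maxl.
Qed.

Definition fps_infprod (i0 : nat) (F : nat -> fps) : fps :=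
  fps_lim (fun N => \prod_(i0 <= i < N) F i).

Lemma fps_infprodE i0 F m N0 : (i0 <= N0)%N ->
    (forall i j, (N0 <= i)%N -> (j <= m)%N -> fcoef (F i) j = fcoef 1 j) ->
  fcoef (fps_infprod i0 F) m = fcoef (\prod_(i0 <= i < N0) F i) m.
Proof.
move=> i0N0 F1; apply: (@fps_limE _ _ _ N0) => N.
elim: N => [|N IHN]; first by rewrite leqn0 => /eqP ->.
rewrite leq_eqVlt => /predU1P[<- //|]; rewrite ltnS => N0N.
rewrite big_nat_recr ?(leq_trans i0N0) //= -[RHS]IHN //.
rewrite -[in RHS](mulr1 (\prod_(i0 <= i < N) F i)) !fcoefM.
by apply: eq_bigr => i _; rewrite F1 // leq_subr.
Qed.

(* The q-Pochhammer symbol (a; b)_oo. *)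
Definition qpoch (a b : fps) : fps := fps_infprod 0 (fun i => 1 - a * b ^+ i).

Definition gk (k : nat) : nat := ((k * (3 * k + 1)) %/ 2)%N.

(* n (3 n - 1) / 2 is a nonnegative integer for every n : int. *)
Definition pent (n : int) : nat := `|((n * (3 * n - 1)) %/ 2)%Z|%N.

(* The sum over -k <= n <= k is indexed by j = n + k. *)
Definition pent_sum (k : nat) : fps :=
  \sum_(j < (2 * k).+1)
    let n : int := j%:Z - k%:Z in (-1) ^ n * fps_q ^+ pent n.

Definition Chat (k : nat) : fps :=
  (-1) ^+ (k - 1) * (1 - (qpoch fps_q fps_q)^-1 * pent_sum k) *
  fps_infprod 1
    (fun n => qpoch (fps_q ^+ (2 ^ n * n)) (fps_q ^+ (2 ^ n.+1 * n))).

(* Main.v *)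
(* Let P be the product over n and F = P / (q;q)_oo.  Writing each m > 0 uniquely
   as 2^n (2i+1), the factor 1 - q^(2^n n (2i+1)) of P is divisible, with a
   quotient having nonnegative coefficients, by the factor 1 - q^m of (q;q)_oo.
   Only the factors 1 - q^m with m odd remain in the denominator, so (1 - q) F has
   nonnegative coefficients and (1 - q^3) F positive ones.  By the pentagonal
   number theorem the k-th series is F times
     sum_{j > k} (-1)^(j-k-1) (q^(j(3j-1)/2) + q^(j(3j+1)/2)),
   whose n-th coefficient is an alternating sum with nonincreasing terms, the
   first being larger than the second as soon as it is nonzero. *)

Require Import Defs.
From HB Require Import structures.
From mathcomp Require Import all_boot all_order all_algebra.
From mathcomp Require Import zify ring lra.

Set Implicit Arguments.
Unset Strict Implicit.
Unset Printing Implicit Defensive.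

Import Order.TTheory GRing.Theory Num.Theory.
Local Open Scope ring_scope.

(** * Finite identities: Shanks' terms and dyadic factorization *)

Section CommutativeRing.

Variables (R : comNzRingType) (x : R).

(** For j <= n the product is (x;x)_n / (x;x)_j, written without division. *)
Definition shanks_term (n j : nat) : R :=
  (-1) ^+ j * (\prod_(j <= i < n) (1 - x ^+ i.+1)) * x ^+ (n * j + 'C(j.+1, 2)).

Lemma shanks_termS n j : (j <= n)%N ->
  shanks_term n.+1 j = x ^+ j * (1 - x ^+ n.+1) * shanks_term n j.
Proof.
move=> jn; rewrite /shanks_term big_nat_recr //= mulSn -addnA exprD; ring.
Qed.

(** Writing T for the term, this and [shanks_termS] give T(n+1,j+1) - T(n,j+1) = x^(n+1+j) T(n,j) -
    x^(n+2+j) T(n,j+1), so sums over j telescope. *)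
Lemma shanks_termE n j : (j < n)%N ->
  (x ^+ j.+1 - 1) * shanks_term n j.+1 = x ^+ (n.+1 + j) * shanks_term n j.
Proof.
move=> jn; rewrite /shanks_term (big_ltn jn) [(-1) ^+ _]exprS.
have -> : (n * j.+1 + 'C(j.+2, 2) = n.+1 + j + (n * j + 'C(j.+1, 2)))%N.
  by rewrite [in LHS]binS bin1 mulnS; lia.
by rewrite [x ^+ (_ + _ + _)]exprD; ring.
Qed.

(* Shanks' finite form of the pentagonal number theorem. *)
Lemma shanks_sumS n :
  \sum_(j < n.+2) shanks_term n.+1 j = \sum_(j < n.+1) shanks_term n j +
    (-1) ^+ n.+1 * (x ^+ (n.+1 * n + 'C(n.+2, 2)) + x ^+ (n.+1 * n.+1 + 'C(n.+2, 2))).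
Proof.
have partial m : (m <= n)%N -> \sum_(j < m.+1) shanks_term n.+1 j =
    \sum_(j < m.+1) shanks_term n j - x ^+ (n.+1 + m) * shanks_term n m.
  elim: m => [|m IHm] mn.
    by rewrite !big_ord1 shanks_termS // addn0 expr0; ring.
  rewrite big_ord_recr IHm 1?ltnW // [in RHS]big_ord_recr /= shanks_termS //.
  by rewrite -shanks_termE // [x ^+ (_ + m.+1)]exprD; ring.
rewrite big_ord_recr partial //= /shanks_term !big_geq // !mulr1.
rewrite -addrA; congr (_ + _).
have -> : (n.+1 * n + 'C(n.+2, 2) = n.+1 + n + (n * n + 'C(n.+1, 2)))%N.
  by rewrite binS bin1; lia.
by rewrite [x ^+ (_ + _ + _)]exprD exprS; ring.
Qed.

Lemma prod_even_odd (f : nat -> R) M :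
  \prod_(1 <= m < 2 * M.+1) f m =
  (\prod_(i < M.+1) f (2 * i).+1) * \prod_(1 <= m < M.+1) f (2 * m)%N.
Proof.
elim: M => [|M IHM]; first by rewrite big_nat1 big_ord1 big_geq // mulr1.
have -> : (2 * M.+2 = (2 * M.+1).+2)%N by lia.
rewrite big_nat_recr //= big_nat_recr //= IHM.
by rewrite [in RHS]big_ord_recr /= [\prod_(1 <= _ < M.+2) _]big_nat_recr //=; ring.
Qed.

End CommutativeRing.

(** The odd exponents form the block n = 0; the even ones repeat the product at x^2, with L lowered
    by one and n shifted. *)
Lemma prod_dyadic (R : comNzRingType) (x : R) L :
  \prod_(1 <= m < 2 ^ L) (1 - x ^+ m) =
  \prod_(0 <= n < L) \prod_(i < 2 ^ (L - n.+1)) (1 - x ^+ (2 ^ n * (2 * i).+1)).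
Proof.
elim: L x => [|L IHL] x; first by rewrite expn0 !big_geq.
rewrite expnS; have /prednK <- : (0 < 2 ^ L)%N by rewrite expn_gt0.
rewrite prod_even_odd prednK ?expn_gt0 // big_nat_recl //= subSS subn0.
congr (_ * _); first by apply: eq_bigr => i _; rewrite expn0 mul1n.
under eq_bigr do rewrite exprM.
rewrite IHL; apply: eq_bigr => n _; rewrite subSS.
by apply: eq_bigr => i _; rewrite -exprM expnS mulnA.
Qed.

(** * Alternating sums *)

Lemma alternating_sum_bounds (t : nat -> int) n :
    (forall i, 0 <= t i) -> (forall i, t i.+1 <= t i) ->
  0 <= \sum_(i < n) (-1) ^+ i * t i <= t 0%N.
Proof.
elim: n t => [|n IHn] t t0 ta; first by rewrite big_ord0 lexx t0.
rewrite big_ord_recl /= mul1r.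
have -> : \sum_(i < n) (-1) ^+ bump 0 i * t (bump 0 i) =
    - \sum_(i < n) (-1) ^+ i * t i.+1.
  by rewrite -sumrN; apply: eq_bigr => i _; rewrite exprS !mulN1r mulNr.
have := IHn (t \o succn) (fun i => t0 i.+1) (fun i => ta i.+1).
by have := ta 0%N => /=; lra.
Qed.

(** What follows t 0 is minus an alternating sum of the same kind, hence at least - t 1. *)
Lemma alternating_sum_ge (t : nat -> int) n :
    (forall i, 0 <= t i) -> (forall i, t i.+1 <= t i) ->
  t 0%N - t 1%N <= \sum_(i < n.+1) (-1) ^+ i * t i.
Proof.
move=> t0 ta; rewrite big_ord_recl /= mul1r.
have -> : \sum_(i < n) (-1) ^+ bump 0 i * t (bump 0 i) =
    - \sum_(i < n) (-1) ^+ i * t i.+1.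
  by rewrite -sumrN; apply: eq_bigr => i _; rewrite exprS !mulN1r mulNr.
rewrite lerD2l lerN2.
by case/andP: (@alternating_sum_bounds (t \o succn) n
  (fun i => t0 i.+1) (fun i => ta i.+1)).
Qed.

(** * Coefficients and congruences modulo powers of q *)

Lemma fcoef_sum I (r : seq I) (P : pred I) (F : I -> fps) n :
  fcoef (\sum_(i <- r | P i) F i) n = \sum_(i <- r | P i) fcoef (F i) n.
Proof. by elim/big_rec2: _ => // i y1 y2 _ <-. Qed.

Lemma fcoefXnM a f n :
  fcoef (fps_q ^+ a * f) n = if (a <= n)%N then fcoef f (n - a) else 0.
Proof.
have qM g m : fcoef (fps_q * g) m.+1 = fcoef g m.
  rewrite fcoefM !big_ord_recl /= mul0r add0r big1 ?addr0 ?subSS ?subn0 ?mul1r //.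
  by move=> i _; rewrite mul0r.
have q0 g : fcoef (fps_q * g) 0 = 0 by rewrite fcoefM big_ord1 mul0r.
elim: a n => [|a IHa] n; first by rewrite mul1r subn0.
rewrite exprS -mulrA; case: n => [|n]; first by rewrite q0.
by rewrite qM IHa subSS.
Qed.

Lemma fcoefXn a n : fcoef (fps_q ^+ a) n = (n == a)%:R.
Proof.
rewrite -[fps_q ^+ a]mulr1 fcoefXnM fcoef1.
case: leqP => h; first by have -> : (n - a == 0)%N = (n == a) by lia.
by have -> : (n == a) = false by lia.
Qed.

Lemma fcoef_signM k f n : fcoef ((-1) ^+ k * f) n = (-1) ^+ k * fcoef f n.
Proof.
by elim: k => [|k IHk]; rewrite ?mul1r // !exprS !mulN1r !mulNr fcoefN IHk.
Qed.

(** Congruence modulo q^M, under which the infinite products become finite. *)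
Definition eqfps (M : nat) (f g : fps) :=
  forall i, (i < M)%N -> fcoef f i = fcoef g i.

Lemma eqfps_refl M f : eqfps M f f. Proof. by []. Qed.

Lemma eqfps_sym M f g : eqfps M f g -> eqfps M g f.
Proof. by move=> fg i /fg. Qed.

Lemma eqfps_trans M f g h : eqfps M f g -> eqfps M g h -> eqfps M f h.
Proof. by move=> fg gh i iM; rewrite fg ?gh. Qed.

Lemma eqfps_sub M f f' g g' :
  eqfps M f f' -> eqfps M g g' -> eqfps M (f - g) (f' - g').
Proof. by move=> ff gg i iM; rewrite !fcoefD !fcoefN ff ?gg. Qed.

Lemma eqfps_mul M f f' g g' :
  eqfps M f f' -> eqfps M g g' -> eqfps M (f * g) (f' * g').
Proof.
move=> ff gg n nM; rewrite !fcoefM; apply: eq_bigr => i _.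
by rewrite ff ?gg // (leq_ltn_trans _ nM) ?leq_subr // -ltnS.
Qed.

Lemma eqfps_prod M m n (F G : nat -> fps) :
    (forall i, (m <= i < n)%N -> eqfps M (F i) (G i)) ->
  eqfps M (\prod_(m <= i < n) F i) (\prod_(m <= i < n) G i).
Proof.
move=> FG; rewrite big_nat_cond [X in eqfps _ _ X]big_nat_cond.
elim/big_rec2: _ => [|i f g]; first exact: eqfps_refl.
by rewrite andbT => imn fg; apply: eqfps_mul => //; apply: FG.
Qed.

Lemma eqfps_1subXn M a : (M <= a)%N -> eqfps M (1 - fps_q ^+ a) 1.
Proof.
move=> Ma i iM; rewrite fcoefD fcoefN fcoefXn.
have /negbTE -> : i != a by lia.
by rewrite oppr0 addr0.
Qed.

Lemma eqfps_qpoch M a b I : (M <= a + b * I)%N ->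
  eqfps M (qpoch (fps_q ^+ a) (fps_q ^+ b))
          (\prod_(i < I) (1 - fps_q ^+ (a + b * i))).
Proof.
move=> MI m mM; rewrite -(big_mkord xpredT (fun i => 1 - fps_q ^+ (a + b * i))).
rewrite /qpoch (@fps_infprodE _ _ _ I) //.
  by under eq_bigr do rewrite -exprM -exprD.
move=> i j Ii jm; rewrite -exprM -exprD (@eqfps_1subXn M) //; last by lia.
by rewrite (leq_trans MI) // leq_add2l leq_mul2l Ii orbT.
Qed.

(** * Series with nonnegative coefficients *)

Definition fps_ge0 (f : fps) := forall n, 0 <= fcoef f n.

Lemma fps_ge0M f g : fps_ge0 f -> fps_ge0 g -> fps_ge0 (f * g).
Proof. by move=> f0 g0 n; rewrite fcoefM sumr_ge0 // => i _; rewrite mulr_ge0. Qed.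

Lemma fps_ge0_prod I (r : seq I) (P : pred I) (F : I -> fps) :
  (forall i, P i -> fps_ge0 (F i)) -> fps_ge0 (\prod_(i <- r | P i) F i).
Proof.
move=> F0; elim/big_ind: _ => [n|f g|i Pi]; [|exact: fps_ge0M|exact: F0].
by rewrite /= ler0n.
Qed.

Lemma fcoef0M f g : fcoef (f * g) 0 = fcoef f 0 * fcoef g 0.
Proof. by rewrite fcoefM big_ord1. Qed.

Lemma fcoef0_prod I (r : seq I) (P : pred I) (F : I -> fps) :
  (forall i, P i -> 0 < fcoef (F i) 0) -> 0 < fcoef (\prod_(i <- r | P i) F i) 0.
Proof.
move=> F0; elim/big_ind: _ => // f g f0 g0.
by rewrite fcoef0M mulr_gt0.
Qed.

(** The series 1 / (1 - q^a) when a > 0. *)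
Definition geom (a : nat) : fps := Fps (fun n => (a %| n)%:R).

Lemma geom_inv a : (0 < a)%N -> (1 - fps_q ^+ a) * geom a = 1.
Proof.
move=> a0; apply/fpsP => n; rewrite mulrBl mul1r fcoefD fcoefN fcoefXnM fcoef1 /=.
case: leqP => [an|na].
  rewrite dvdn_subl ?dvdnn // subrr; suff /negbTE -> : n != 0%N by []; lia.
rewrite subr0; case: n na => [|n] na; first by rewrite dvdn0.
by rewrite gtnNdvd.
Qed.

Lemma fps_ge0_geom a : fps_ge0 (geom a).
Proof. by move=> n /=; rewrite ler0n. Qed.

(** Multiplication by 1 / (1 - q) forms partial sums, each of which contains the constant term of
    f. *)
Lemma fps_gt0_geom1M f n :
  fps_ge0 f -> 0 < fcoef f 0 -> 0 < fcoef (geom 1 * f) n.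
Proof.
move=> f0 f00; rewrite mulrC fcoefM big_ord_recl /= dvd1n mulr1.
by rewrite ltr_wpDr // sumr_ge0 // => i _; rewrite dvd1n mulr1.
Qed.

(** * The quotient F = P / (q;q)_oo *)

Local Notation dyadic_prod := (fps_infprod 1
    (fun n => qpoch (fps_q ^+ (2 ^ n * n)) (fps_q ^+ (2 ^ n.+1 * n)))).

Local Notation euler_prod := (qpoch fps_q fps_q).

Local Notation quotient := (dyadic_prod / euler_prod).

Lemma eqfps_euler_prod N M : (M <= N.+1)%N ->
  eqfps M euler_prod (\prod_(1 <= m < N.+1) (1 - fps_q ^+ m)).
Proof.
move=> MN; have := @eqfps_qpoch M 1 1 N; rewrite expr1 => /(_ _).
rewrite big_add1 big_mkord; under eq_bigr do rewrite mul1n add1n.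
by apply; lia.
Qed.


(** For n >= L the lowest exponent is 2^n n >= 2^L; for n < L the first exponent dropped is 2^n n +
    2^L n. The index set left is that of [prod_dyadic] without n = 0. *)
Lemma eqfps_dyadic_prod L : (0 < L)%N -> eqfps (2 ^ L) dyadic_prod
  (\prod_(1 <= n < L) \prod_(i < 2 ^ (L - n.+1))
     (1 - fps_q ^+ (2 ^ n * (2 * i).+1 * n))).
Proof.
move=> L0 m mL; rewrite (@fps_infprodE _ _ _ L) //.
  apply: eqfps_prod m mL => n /andP[n0 nL] m mL.
  rewrite (@eqfps_qpoch (2 ^ L) _ _ (2 ^ (L - n.+1))) //.
    congr fcoef; apply: eq_bigr => i _; congr (1 - fps_q ^+ _).
    by rewrite expnS; lia.
  rewrite mulnAC -expnD subnKC //; case: n n0 nL => // n _ _.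
  by rewrite (leq_trans _ (leq_addl _ _)) ?leq_pmulr.
move=> n j Ln jm; rewrite (@eqfps_qpoch (2 ^ L) _ _ 0) ?big_ord0 //.
  rewrite muln0 addn0; case: n Ln => [|n] Ln; first by lia.
  by rewrite (@leq_trans (2 ^ n.+1)) ?leq_exp2l // leq_pmulr.
exact: leq_ltn_trans mL.
Qed.

(* Every m > 0 is uniquely 2 ^ n (2 i + 1).  Dividing 1 - y ^ n by 1 - y with
   y = q ^ (2 ^ n (2 i + 1)) leaves 1 + y + ... + y ^ (n - 1). *)
Definition kept_parts L : fps :=
  \prod_(1 <= n < L) \prod_(i < 2 ^ (L - n.+1))
     \sum_(t < n) fps_q ^+ (2 ^ n * (2 * i).+1 * t).

(** The odd product on the left supplies the block n = 0 of [prod_dyadic], which P lacks; the other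
    blocks match by factoring 1 - y^n. *)
Lemma kept_partsE L : (0 < L)%N ->
  (\prod_(1 <= n < L) \prod_(i < 2 ^ (L - n.+1))
     (1 - fps_q ^+ (2 ^ n * (2 * i).+1 * n))) *
  (\prod_(i < 2 ^ L.-1) (1 - fps_q ^+ (2 * i).+1)) =
  kept_parts L * \prod_(1 <= m < 2 ^ L) (1 - fps_q ^+ m).
Proof.
move=> L0; rewrite prod_dyadic [X in _ = _ * X]big_ltn // mulrCA mulrC subn1 expn0.
congr (_ * _); first by apply: eq_bigr => i _; rewrite mul1n.
rewrite /kept_parts -big_split; apply: eq_bigr => n _.
rewrite -big_split; apply: eq_bigr => i _ /=.
rewrite exprM -[LHS]opprB subrX1 -mulNr opprB mulrC; congr (_ * _).
by apply: eq_bigr => t _; rewrite -exprM.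
Qed.

Lemma fps_ge0_Xn a : fps_ge0 (fps_q ^+ a).
Proof. by move=> n; rewrite fcoefXn ler0n. Qed.

Lemma fps_ge0_kept_parts L : fps_ge0 (kept_parts L).
Proof.
do 2!apply: fps_ge0_prod => ? _; move=> n; rewrite fcoef_sum sumr_ge0 // => t _.
exact: fps_ge0_Xn.
Qed.

Lemma fcoef0_kept_parts L : 0 < fcoef (kept_parts L) 0.
Proof.
(* The range condition is kept because n > 0 makes the inner sum contain its term t = 0, equal to
   1. *)
rewrite /kept_parts big_nat_cond.
apply: fcoef0_prod => -[|n] // _; apply: fcoef0_prod => i _.
rewrite fcoef_sum big_ord_recl muln0 expr0 ltr_pwDl //.
by apply: sumr_ge0 => t _; apply: fps_ge0_Xn.
Qed.

Lemma euler_prod_unit : euler_prod \is a GRing.unit.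
Proof.
rewrite unfold_in /= /fps_unit (@eqfps_euler_prod 1 1) // big_nat1.
by rewrite fcoefD fcoefN fcoefXn.
Qed.

(** The factors for m = 1 and m = 3 are split off, one for monotonicity and one for strict growth; L
    > 1 ensures 3 < 2^L. *)
Lemma quotient_factor L : (1 < L)%N -> exists2 f : fps,
  fps_ge0 f /\ 0 < fcoef f 0 &
  eqfps (2 ^ L) quotient (geom 1 * (geom 3 * f)).
Proof.
move=> L1; have L0 := ltnW L1.
(* The second product runs over the odd m with 5 <= m < 2^L. *)
exists (kept_parts L * \prod_(i < 2 ^ L.-1 - 2) geom (2 * i.+2).+1).
  split; first apply: fps_ge0M (@fps_ge0_kept_parts _) _.
    by apply: fps_ge0_prod => i _; apply: fps_ge0_geom.
  rewrite fcoef0M mulr_gt0 ?fcoef0_kept_parts //.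
  by apply: fcoef0_prod => i _.
have -> : geom 1 * (geom 3 * (kept_parts L *
    \prod_(i < 2 ^ L.-1 - 2) geom (2 * i.+2).+1)) =
    kept_parts L * \prod_(i < 2 ^ L.-1) geom (2 * i).+1.
  have eL : (2 ^ L.-1 = (2 ^ L.-1 - 2).+2)%N.
    by case: L L1 L0 => [|[|L]] //= _ _; rewrite expnS; have := expn_gt0 2 L; lia.
  by rewrite [in RHS]eL !big_ord_recl /=; ring.
set D := \prod_(1 <= m < 2 ^ L) (1 - fps_q ^+ m).
set O := \prod_(i < 2 ^ L.-1) (1 - fps_q ^+ (2 * i).+1).
set G := \prod_(i < 2 ^ L.-1) geom (2 * i).+1.
have OG : O * G = 1.
  by rewrite -big_split big1 // => i _ /=; rewrite geom_inv.
have qD : eqfps (2 ^ L) D euler_prod.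
  (* This truncation has one extra factor, m = 2^L, congruent to 1. *)
  apply: eqfps_sym; have := @eqfps_euler_prod (2 ^ L) (2 ^ L) (leqnSn _).
  move/eqfps_trans; apply; rewrite big_nat_recr ?expn_gt0 //= -[X in eqfps _ _ X]mulr1.
  by apply: eqfps_mul; [exact: eqfps_refl | exact: eqfps_1subXn].
have -> : quotient = dyadic_prod * O / euler_prod * G
  by rewrite -[LHS]mulr1 -OG; ring.
apply: eqfps_mul; last exact: eqfps_refl.
have -> : kept_parts L = kept_parts L * euler_prod / euler_prod
  by rewrite mulrK ?euler_prod_unit.
apply: eqfps_mul; last exact: eqfps_refl.
apply: eqfps_trans (eqfps_mul (eqfps_dyadic_prod L0) (@eqfps_refl _ _)) _.
by rewrite kept_partsE //; apply: eqfps_mul; [exact: eqfps_refl | exact: qD].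
Qed.

(** Multiplying by 1 - q cancels [geom 1] and leaves nonnegative coefficients. *)
Lemma quotient_mono n : fcoef quotient n <= fcoef quotient n.+1.
Proof.
have [//|f [f0 _] Ef] := @quotient_factor n.+2.
have nL : (n.+1 < 2 ^ n.+2)%N := ltn_trans (ltnSn _) (@ltn_expl 2 n.+2 isT).
have := @eqfps_mul _ _ _ _ _ (@eqfps_refl _ (1 - fps_q ^+ 1)) Ef n.+1 nL.
rewrite [in RHS]mulrA geom_inv // mul1r.
rewrite mulrBl mul1r fcoefD fcoefN fcoefXnM /= subSS subn0.
by move=> E; rewrite -subr_ge0 E; exact: (fps_ge0M (@fps_ge0_geom 3) f0).
Qed.

(** Multiplying by 1 - q^3 cancels [geom 3]; the remaining [geom 1] makes every coefficient
    positive. *)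
Lemma quotient_jump n :
  0 < fcoef quotient n -
      if (3 <= n)%N then fcoef quotient (n - 3) else 0.
Proof.
have [//|f [f0 f00] Ef] := @quotient_factor n.+2.
have nL : (n < 2 ^ n.+2)%N := ltn_trans (leqnSn _) (@ltn_expl 2 n.+2 isT).
have := @eqfps_mul _ _ _ _ _ (@eqfps_refl _ (1 - fps_q ^+ 3)) Ef n nL.
rewrite [_ * (geom 1 * _)]mulrCA [_ * (geom 3 * f)]mulrA geom_inv // mul1r.
rewrite mulrBl mul1r fcoefD fcoefN fcoefXnM => ->.
exact: fps_gt0_geom1M.
Qed.

Lemma quotient_gt0 n : 0 < fcoef quotient n.
Proof.
elim: n => [|n IHn]; last exact: lt_le_trans IHn (quotient_mono n).
by have := quotient_jump 0; rewrite subr0.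
Qed.

Lemma quotient_shift_ge0 a n : 0 <= fcoef (fps_q ^+ a * quotient) n.
Proof. by rewrite fcoefXnM; case: ifP => // _; rewrite ltW ?quotient_gt0. Qed.

Lemma quotient_homo m n : (m <= n)%N ->
  fcoef quotient m <= fcoef quotient n.
Proof.
move=> /subnKC <-; elim: (n - m)%N => [|d IHd]; first by rewrite addn0.
by rewrite addnS (le_trans IHd) ?quotient_mono.
Qed.

Lemma quotient_shift_anti a b n : (a <= b)%N ->
  fcoef (fps_q ^+ b * quotient) n <= fcoef (fps_q ^+ a * quotient) n.
Proof.
move=> ab; rewrite !fcoefXnM; case: leqP => bn.
  by rewrite (leq_trans ab bn) quotient_homo // leq_sub2l.
by case: ifP => // _; rewrite ltW ?quotient_gt0.
Qed.

Lemma quotient_shift_lt a b n : (a + 3 <= b)%N -> (a <= n)%N ->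
  fcoef (fps_q ^+ b * quotient) n < fcoef (fps_q ^+ a * quotient) n.
Proof.
(* This reduces to b = a + 3. *)
move=> ab an; apply: le_lt_trans (quotient_shift_anti n ab) _.
rewrite !fcoefXnM an -subr_gt0; have := quotient_jump (n - a).
by rewrite subnDA leq_subRL //.
Qed.

(** * Pentagonal numbers and partial pentagonal sums *)

Lemma pent_nat j : pent j%:Z = (j * j + 'C(j, 2))%N.
Proof.
rewrite /pent; have -> : j%:Z * (3 * j%:Z - 1) = (j * j + 'C(j, 2))%N%:Z * 2.
  have := mul_bin_left j 1; rewrite bin1; case: j => [|j] //=; nia.
by rewrite mulzK.
Qed.

Lemma pent_opp j : pent (- j%:Z) = (j * j + 'C(j.+1, 2))%N.
Proof.
rewrite /pent; have -> : - j%:Z * (3 * - j%:Z - 1) = (j * j + 'C(j.+1, 2))%N%:Z * 2.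
  have := mul_bin_left j 1; rewrite binS !bin1; case: j => [|j] //=; nia.
by rewrite mulzK.
Qed.

(** The threshold of the theorem is the smallest exponent left out of [pent_sum k]. *)
Lemma pent_gk k : pent k.+1%:Z = (gk k + (2 * k + 1))%N.
Proof.
rewrite pent_nat /gk; have -> : (k * (3 * k + 1) = (k * k + 'C(k.+1, 2)) * 2)%N.
  have := mul_bin_left k 1; rewrite binS !bin1; case: k => [|k] //=; nia.
rewrite mulnK //; lia.
Qed.

Lemma signz (R : unitRingType) (n : int) : (-1) ^ n = (-1) ^+ `|n|%N :> R.
Proof. by case: n => n //; rewrite NegzE -exprnN -exprVn invrN1 abszN. Qed.

Lemma pent_sum0 : pent_sum 0 = 1.
Proof. by rewrite /pent_sum big_ord1 /= subrr expr0z mul1r. Qed.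

Lemma pent_sumS k : pent_sum k.+1 = pent_sum k +
  (-1) ^+ k.+1 * (fps_q ^+ pent k.+1%:Z + fps_q ^+ pent (- k.+1%:Z)).
Proof.
pose t (n : int) : fps := (-1) ^+ `|n|%N * fps_q ^+ pent n.
have E m : pent_sum m = \sum_(0 <= j < (2 * m).+1) t (j%:Z - m%:Z).
  by rewrite big_mkord; apply: eq_bigr => j _; rewrite /= signz.
rewrite !E; have -> : (2 * k.+1 = (2 * k).+2)%N by lia.
rewrite big_nat_recl // big_nat_recr //= sub0r.
have -> : (2 * k).+2%:Z - k.+1%:Z = k.+1%:Z by lia.
have -> : \sum_(0 <= i < (2 * k).+1) t (i.+1%:Z - k.+1%:Z) =
    \sum_(0 <= i < (2 * k).+1) t (i%:Z - k%:Z).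
  by apply: eq_bigr => i _; congr t; lia.
by rewrite /t abszN absz_nat; ring.
Qed.

Lemma pent_sum_shanks N : pent_sum N = \sum_(j < N.+1) shanks_term fps_q N j.
Proof.
elim: N => [|N IHN].
  by rewrite pent_sum0 big_ord1 /shanks_term big_geq // !mul1r.
rewrite pent_sumS IHN shanks_sumS pent_nat pent_opp.
by congr (_ + _ * (_ ^+ _ + _)); rewrite !binS bin0 bin1; lia.
Qed.

(** In Shanks' sum the term j = 0 is (q;q)_N, and those with j >= 1 are divisible by q^(N+1). *)
Lemma eqfps_pent_sum N : eqfps N.+1 (pent_sum N) euler_prod.
Proof.
move=> m mN; rewrite pent_sum_shanks (@eqfps_euler_prod N N.+1) //.
rewrite big_ord_recl fcoefD fcoef_sum big1 ?addr0 => [|j _].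
  by rewrite /shanks_term muln0 !mul1r mulr1 big_add1.
rewrite /shanks_term mulrC fcoefXnM ifF //=.
by rewrite /bump /= mulnDr muln1 binS bin1; lia.
Qed.

(** * The coefficients of [Chat k] and their signs *)

Lemma fcoef_Chat k n : (0 < k)%N -> fcoef (Chat k) n =
  \sum_(i < n.+1) (-1) ^+ i *
    (fcoef (fps_q ^+ pent (k + i).+1%:Z * quotient) n +
     fcoef (fps_q ^+ pent (- (k + i).+1%:Z) * quotient) n).
Proof.
(* Since n <= N, the constant 1 may be replaced by [pent_sum N] over (q;q)_oo. The n + 1 terms
   beyond k leave a nonempty sum, as [alternating_sum_ge] requires. *)
move=> k0; pose N := (k + n.+1)%N.
(* The first new sign (-1)^(k+1) equals (-1)^(k-1), so it cancels the sign in [Chat]. *)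
have diff m : pent_sum (k + m) - pent_sum k = (-1) ^+ k.-1 *
   \sum_(i < m) (-1) ^+ i *
     (fps_q ^+ pent (k + i).+1%:Z + fps_q ^+ pent (- (k + i).+1%:Z)).
  elim: m => [|m IHm]; first by rewrite addn0 subrr big_ord0 mulr0.
  rewrite addnS pent_sumS addrAC IHm big_ord_recr /=.
  rewrite [in RHS]mulrDr [in X in _ = _ + X]mulrA; congr (_ + _ * _).
  by case: k k0 {N IHm} => // k _; rewrite /= addSn 2!exprS !mulN1r opprK exprD.
have -> : fcoef (Chat k) n =
    fcoef ((-1) ^+ k.-1 * (pent_sum N - pent_sum k) * quotient) n.
  have nN : (n < N.+1)%N by rewrite /N; lia.
  have -> : (-1) ^+ k.-1 * (pent_sum N - pent_sum k) * quotient =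
     (-1) ^+ k.-1 * (euler_prod^-1 * pent_sum N - euler_prod^-1 * pent_sum k) *
     dyadic_prod by ring.
  suff E : eqfps N.+1 (Chat k)
      ((-1) ^+ k.-1 * (euler_prod^-1 * pent_sum N - euler_prod^-1 * pent_sum k) *
       dyadic_prod) by exact: E.
  rewrite /Chat subn1; apply: eqfps_mul; last exact: eqfps_refl.
  apply: eqfps_mul; first exact: eqfps_refl.
  apply: eqfps_sub; last exact: eqfps_refl.
  rewrite -(mulVr euler_prod_unit); apply: eqfps_mul; first exact: eqfps_refl.
  exact/eqfps_sym/eqfps_pent_sum.
rewrite diff mulrA -expr2 sqrr_sign mul1r mulr_suml fcoef_sum.
by apply: eq_bigr => i _; rewrite -mulrA mulrDl fcoef_signM fcoefD.
Qed.

Theorem theorem4 :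
  forall k : nat, (1 <= k)%N ->
    (forall n : nat, 0 <= fcoef (Chat k) n) /\
    (forall n : nat, 0 < fcoef (Chat k) n <-> (gk k + (2 * k + 1) <= n)%N).
Proof.
move=> k k0.
pose t n i := fcoef (fps_q ^+ pent (k + i).+1%:Z * quotient) n +
     fcoef (fps_q ^+ pent (- (k + i).+1%:Z) * quotient) n.
have t_ge0 n i : 0 <= t n i by rewrite addr_ge0 ?quotient_shift_ge0.
have binSS m : ('C(m.+1, 2) = 'C(m, 2) + m)%N by rewrite binS bin1 addnC.
(* The gap is 3j + 4; the bound 3 is the one in [quotient_shift_lt]. *)
have pent_jump j : (pent j.+1%:Z + 3 <= pent j.+2%:Z)%N.
  by rewrite !pent_nat (binSS j.+1); lia.
have t_anti n i : t n i.+1 <= t n i.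
  rewrite lerD // quotient_shift_anti // addnS.
    exact: leq_trans (leq_addr _ _) (pent_jump _).
  by rewrite !pent_opp (binSS (k + i).+2); lia.
have Chat_bounds n : 0 <= fcoef (Chat k) n <= t n 0%N.
  by rewrite fcoef_Chat //; apply: alternating_sum_bounds.
split=> [n|n]; first by case/andP: (Chat_bounds n).
rewrite -pent_gk; split=> [|kn].
  (* Below the threshold both shifted coefficients in [t n 0] vanish, so the upper bound is 0. *)
  have /andP[_] := Chat_bounds n; rewrite leqNgt => le_t Chat0.
  apply/negP => nk; move: (lt_le_trans Chat0 le_t).
  rewrite /t addn0 !fcoefXnM leqNgt nk ifF ?addr0 ?ltxx //.
  by move: nk; rewrite pent_nat pent_opp (binSS k.+1); lia.
rewrite fcoef_Chat // (lt_le_trans _ (alternating_sum_ge n (t_ge0 n) (t_anti n))) //.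
(* Only the first members of the pairs need compare strictly: n may lie below the second
   exponent. *)
rewrite subr_gt0 ltr_leD ?quotient_shift_lt ?addn0 ?addn1 //.
  by rewrite quotient_shift_anti // !pent_opp (binSS k.+2); lia.
Qed.
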